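(* For $n\ge1$ define the operator $T_n$ on functions on $[0,1)$ (with Lebesgue measure) by $T_nf(x)=f(nx\bmod 1)$. Then the sequence $(T_n)_{n\ge1}$ is ultimately bad in $L^p$ for all $1<p<\infty$.
   Context: For a function $f$ on a measure space $(X,\mu)$, $\|f\|_{p,\infty}=\sup_{y>0}y\cdot\mu\{x:|f(x)|\ge y\}^{1/p}$. For a sequence $w=(w_t)_{t\in\mathbb N}$ of positive reals and $1<p<\infty$, $C_p(w)=\|w\|_{p,\infty}=\sup_{y>0}y\cdot|\{t:w_t\ge y\}|^{1/p}$. A sequence $(T_n)$ of linear operators on $L^p$ is called ultimately bad in $L^p$ if for every sequence $(w_t)$ of positive reals with $C_p(w)=\infty$, the maximal function of the averages $w_t\frac1{2^t}\sum_{n\le2^t}T_nf(x)$ is not weak $(p,p)$, i.e. there is no constant $C>0$ such that $\big\|\sup_t w_t2^{-t}\sum_{n\le2^t}T_nf\big\|_{p,\infty}\le C\|f\|_p$ for all $f\in L^p$. *)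

(* Defs.v *)
From HB Require Import structures.
From mathcomp Require Import all_boot all_order all_algebra.
From mathcomp Require Import all_classical all_reals all_analysis.
Import Order.TTheory GRing.Theory Num.Theory.
Import numFieldNormedType.Exports.
Set Implicit Arguments.
Unset Strict Implicit.
Unset Printing Implicit Defensive.
Local Open Scope classical_set_scope.
Local Open Scope ring_scope.

(* Since 0 < 1/p, the power sends a distribution value +oo to +oo. *)
Definition weak_Lnorm {d} {X : measurableType d} {R : realType}
    (mu : {measure set X -> \bar R}) (p : R) (f : X -> \bar R) : \bar R :=
  ereal_sup [set (y%:E * (mu [set x | y%:E <= `|f x|]) `^ p^-1)%E
            | y in [set y : R | 0 < y]].

Definition weak_seq_norm {R : realType} (p : R) (w : nat -> R) : \bar R :=
  weak_Lnorm (@counting nat R) p (EFin \o w).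

(* An operator on L^p, presented on representatives: it preserves L^p,
   respects equality mu-a.e., and is linear mu-a.e. on L^p. *)
Definition Lp_linear_operator {d} {X : measurableType d} {R : realType}
    (mu : {measure set X -> \bar R}) (p : R) (T : (X -> R) -> (X -> R)) : Prop :=
  [/\ forall f, f \in Lfun mu p%:E -> T f \in Lfun mu p%:E,
      forall f g, f \in Lfun mu p%:E -> g \in Lfun mu p%:E ->
        f = g %[ae mu] -> T f = T g %[ae mu]
    & forall (a : R) f g, f \in Lfun mu p%:E -> g \in Lfun mu p%:E ->
        T (fun x => a * f x + g x)
          = (fun x => a * T f x + T g x) %[ae mu]].

(* No absolute value inside the supremum: weak_Lnorm takes it outside. *)
Definition weighted_maximal {X : Type} {R : realType}
    (T : nat -> (X -> R) -> (X -> R)) (w : nat -> R) (f : X -> R) (x : X) : \bar R :=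
  ereal_sup (range (fun t : nat =>
    (w t * ((2 ^ t)%:R^-1 * \sum_(1 <= n < (2 ^ t).+1) T n f x))%:E)).

Definition weak_type {d} {X : measurableType d} {R : realType}
    (mu : {measure set X -> \bar R}) (p : R) (S : (X -> R) -> (X -> \bar R)) : Prop :=
  exists2 C : R, 0 < C &
    forall f, f \in Lfun mu p%:E ->
      (weak_Lnorm mu p (S f) <= C%:E * Lnorm mu p%:E (EFin \o f))%E.

(* The sequence is indexed from 1; [T 0] plays no role. *)
Definition ultimately_bad {d} {X : measurableType d} {R : realType}
    (mu : {measure set X -> \bar R}) (p : R)
    (T : nat -> (X -> R) -> (X -> R)) : Prop :=
  (forall n, (1 <= n)%N -> Lp_linear_operator mu p (T n)) /\
  (forall w : nat -> R, (forall t, 0 < w t) -> weak_seq_norm p w = +oo%E ->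
     ~ weak_type mu p (weighted_maximal T w)).

(* Lebesgue measure on [0, 1), carried by the real line: functions on [0, 1)
   are represented by functions on R, whose values off [0, 1) are irrelevant. *)
Definition leb01 (R : realType) : {measure set (measurableTypeR R) -> \bar R} :=
  mrestr (@lebesgue_measure R) (measurable_itv `[0, 1[ : measurable (`[0, 1[ : set R)).

Definition frac_part {R : realType} (x : R) : R := x - (Num.floor x)%:~R.

Definition dilation {R : realType} (n : nat) (f : R -> R) (x : R) : R :=
  f (frac_part (n%:R * x)).

(* Main.v *)
Require Import Defs.
From mathcomp Require Import all_boot all_order all_algebra.
From mathcomp Require Import all_classical all_reals all_analysis.
From mathcomp Require Import measurable_realfun.
From mathcomp Require Import ring lra zify.
Import Order.TTheory GRing.Theory Num.Theory.
Import numFieldNormedType.Exports.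
Set Implicit Arguments.
Unset Strict Implicit.
Unset Printing Implicit Defensive.
Local Open Scope classical_set_scope.
Local Open Scope ring_scope.

(** At least half of the integers [n <= 2 ^ t] satisfy [2 ^ t < 2 * n], so the
    [t]-th average mostly moves a point by about [t] in the logarithmic scale
    [log2 n].  Suppose a weak-type bound holds with constant [C], and that
    [w t >= y] for all [t] in a finite set [S].  If the orbits of the dilations
    were copies of the multiplicative semigroup of integers, one would take for
    [f] the indicator of a level set of [log2]: the average number [t] is then
    at least [1/2] at every point lying [t] steps before that level, so the
    maximal function is at least [y / 2] on about [size S] times as many points
    as [f] is supported on.  The weak-type inequality would give
    [(y / 2)^p * size S <= const * C^p] ([weak_type_level_set_le]), with a
    constant that depends on neither [y] nor [S]; hence the weak [L^p] norm of
    [w] is finite.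

    Two facts make this picture literal.

    - Free orbits ([circle_mul_preimages_disjoint]).  Write [h^-1 D] for the set
      of points that multiplication by [h] modulo 1 sends into [D].  These sets
      all have the measure of [D], because the dilations preserve Lebesgue
      measure ([leb01_circle_mul]), and for [D = [1/q, 1/q + 1/q^2)] those with
      [0 < h < q] are pairwise disjoint.  So a finite set of integers [h] can be
      realised inside the circle by the union of the sets [h^-1 D], counting
      measure becoming a multiple of Lebesgue measure.  The total measure may be
      tiny, which is harmless since the weak-type inequality is homogeneous in
      the measure.  If [h = g * n], a point of [h^-1 D] is sent by the dilation
      of ratio [n] into [g^-1 D].  This turns the weak-type inequality into an
      inequality between cardinals of sets of integers ([weak_type_size_le]).

    - Amenability ([folner_smooth]).  The multiplicative semigroup is
      commutative, so finitely many generators produce only polynomially many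
      products of a given length.  This yields finite sets of integers [s] and
      [s'] of comparable sizes such that [h / n] is an integer in [s] for all
      [h] in [s'] and all [n <= K].

    Cutting [s] and [s'] along the levels of [trunc_log 2] gives one inequality
    between cardinals for each level; summing them over all levels avoids
    having to choose a good one. *)

(** * Finite sets of integers almost stable under division *)

Lemma expn_lt_exp2 (K : nat) : exists M, (M.+1 ^ K < 2 ^ M)%N.
Proof.
(* For M + 1 = 2 ^ a the claim reads a * K + 1 < 2 ^ a, and a = 2 * (2 * K + 1)
   is large enough since 2 ^ a is then the square of 2 ^ (a / 2) > a / 2. *)
pose b := K.*2.+1; exists (2 ^ b.*2).-1.
rewrite prednK ?expn_gt0// -expnM ltn_exp2l//.
have hb : (b < 2 ^ b)%N by exact: ltn_expl.
have : (2 ^ b.*2 = 2 ^ b * 2 ^ b)%N by rewrite -expnD addnn.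
have : (b.+1 * b.+1 <= 2 ^ b * 2 ^ b)%N by exact: leq_mul.
rewrite {}/b in hb *; nia.
Qed.

(** Distinct exponents may give the same product, since the factors are all the
    integers up to [K] and not only the primes; only the upper bound
    [size_smooth_products_le] on the number of products matters. *)
Definition smooth_products (K M : nat) : seq nat :=
  undup (codom (fun e : {ffun 'I_K -> 'I_M.+1} =>
    (\prod_(i < K) i.+1 ^ e i)%N)).

Lemma smooth_productsP (K M g : nat) :
  reflect (exists2 e : 'I_K -> nat, (forall i, (e i <= M)%N) &
             g = (\prod_(i < K) i.+1 ^ e i)%N)
          (g \in smooth_products K M).
Proof.
rewrite mem_undup; apply: (iffP codomP) => [[e ->]|[e eM ->]].
  by exists (fun i => e i : nat) => // i; rewrite -ltnS.
exists [ffun i => inord (e i)]; apply: eq_bigr => i _.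
by rewrite ffunE inordK// ltnS.
Qed.

Lemma smooth_products_gt0 (K M g : nat) :
  g \in smooth_products K M -> (0 < g)%N.
Proof.
by move=> /smooth_productsP[e _ ->]; apply: prodn_gt0 => i; rewrite expn_gt0.
Qed.

Lemma size_smooth_products_gt0 (K M : nat) :
  (0 < size (smooth_products K M))%N.
Proof.
suff : 1%N \in smooth_products K M by case: smooth_products.
by apply/smooth_productsP; exists (fun=> 0%N) => //; rewrite big1.
Qed.

Lemma size_smooth_products_le (K M : nat) :
  (size (smooth_products K M) <= M.+1 ^ K)%N.
Proof.
by rewrite (leq_trans (size_undup _))// size_codom card_ffun !card_ord.
Qed.

(** Otherwise the sizes would grow at least like [2 ^ M], whereas they are
    bounded by a polynomial in [M]. *)
Lemma smooth_products_doubling (K : nat) : exists M,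
  (size (smooth_products K M.+1) <= 2 * size (smooth_products K M))%N.
Proof.
have [M HM] := expn_lt_exp2 K.
apply/not_existsP => H.
have grow n : (2 ^ n <= size (smooth_products K n))%N.
  elim: n => [|n IHn]; first by rewrite size_smooth_products_gt0.
  move/negP: (H n); rewrite -ltnNge => /ltnW; apply: leq_trans.
  by rewrite expnS leq_mul2l.
by have := leq_trans (grow M) (size_smooth_products_le K M); rewrite leqNgt HM.
Qed.

(** [K! / n] is the product of the integers up to [K] other than [n], so
    multiplying by it raises every exponent by at most one. *)
Lemma smooth_products_div (K M g n : nat) : g \in smooth_products K M ->
  (0 < n <= K)%N ->
  exists2 g', g' \in smooth_products K M.+1 & (K`! * g = g' * n)%N.
Proof.
move=> /smooth_productsP[e eM ->] /andP[n0 nK].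
have nK' : (n.-1 < K)%N by rewrite prednK.
pose j := Ordinal nK'.
exists (\prod_(i < K) i.+1 ^ (e i + (i != j)))%N.
  apply/smooth_productsP; exists (fun i => e i + (i != j))%N => // i.
  by rewrite -addn1 leq_add// leq_b1.
rewrite fact_prod big_add1 big_mkord -big_split /=.
rewrite (bigD1 j)//= [in RHS](bigD1 j)//= eqxx addn0 prednK// mulnC -!mulnA.
rewrite mulnC -!mulnA [in RHS]mulnCA.
rewrite [in LHS]mulnC mulnCA -!mulnA; congr (_ * (_ * _))%N.
by apply: eq_bigr => i ->; rewrite addn1 expnS.
Qed.

(** Here [s'] consists of the products with exponents at most [M], multiplied
    by [K!] to make them divisible by every [n <= K], and [s] of those with
    exponents at most [M + 1], for an [M] where the sizes do not double. *)
Lemma folner_smooth (K : nat) : exists s s' : seq nat,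
  [/\ uniq s, uniq s', (0 < size s')%N & (size s <= 2 * size s')%N] /\
  [/\ {in s, forall g, (0 < g)%N},
      {in s', forall h, (K <= h)%N} &
      {in s', forall h n, (0 < n <= K)%N ->
         exists2 g, g \in s & h = (g * n)%N}].
Proof.
have [M HM] := smooth_products_doubling K.
exists (smooth_products K M.+1), [seq (K`! * g)%N | g <- smooth_products K M].
rewrite size_map; split; split => //.
- exact: undup_uniq.
- rewrite map_inj_uniq ?undup_uniq// => x y /eqP.
  by rewrite eqn_pmul2l ?fact_gt0// => /eqP.
- exact: size_smooth_products_gt0.
- by move=> g /smooth_products_gt0.
- move=> _ /mapP[g /smooth_products_gt0 g0 ->].
  have : (K <= K`!)%N.
    case: (posnP K) => [->//|K0].
    by apply: dvdn_leq; rewrite ?fact_gt0// dvdn_fact// K0 leqnn.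
  by move/leq_trans; apply; rewrite leq_pmulr.
- by move=> _ /mapP[g gs ->] n; exact: smooth_products_div.
Qed.

(** * Dyadic levels *)

(** Dividing by an [n] in [(2 ^ t / 2, 2 ^ t]] lowers [log2] by more than
    [t - 1] and at most [t]; rounding leaves two possible levels. *)
Lemma trunc_log_quotient (t v g n : nat) : (n <= 2 ^ t < 2 * n)%N ->
  trunc_log 2 (g * n) = (v + t)%N -> (0 < g)%N ->
  (trunc_log 2 g == v) || (trunc_log 2 g == v.+1).
Proof.
move=> /andP[nt tn] hv g0.
have n0 : (0 < n)%N by case: n tn {nt hv} => //; rewrite muln0.
have /andP[lo up] := trunc_log_bounds (ltnSn 1) (leq_mul g0 n0).
have /andP[lo' up'] := trunc_log_bounds (ltnSn 1) g0.
move: lo up; rewrite {}hv => lo up.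
have : (v < (trunc_log 2 g).+1)%N.
  rewrite -(ltn_exp2l _ _ (ltnSn 1)); apply: leq_ltn_trans up'.
  rewrite -(leq_pmul2r (expn_gt0 2 t : (0 < 2 ^ t) = true)%N).
  by rewrite -expnD (leq_trans lo)// leq_mul2l nt orbT.
have : (trunc_log 2 g < v.+2)%N.
  rewrite -(ltn_exp2l _ _ (ltnSn 1)); apply: (leq_ltn_trans lo').
  rewrite -(ltn_pmul2r n0) (leq_trans up)//.
  by rewrite !expnS expnD; nia.
rewrite !ltnS leq_eqVlt ltnS => /orP[/eqP ->|a] b; first by rewrite eqxx orbT.
by rewrite eqn_leq a b.
Qed.

Lemma sum_eq_ord (V a : nat) : (\sum_(v < V) (a == v) = (a < V))%N.
Proof.
elim: V => [|V IHV]; first by rewrite big_ord0.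
by rewrite big_ord_recr /= IHV; lia.
Qed.

(** Each element belongs to at most two pairs of consecutive levels. *)
Lemma sum_level_pairs_le (k : nat -> nat) (s : seq nat) (V : nat) :
  (\sum_(v < V) count (fun g => (k g == v) || (k g == v.+1)) s
     <= 2 * size s)%N.
Proof.
elim: s => [|g s IHs] /=; first by rewrite big1.
rewrite big_split /= mulnS leq_add//.
apply: (@leq_trans (\sum_(v < V) ((k g == v) + ((k g).-1 == v)))%N).
  by apply: leq_sum => v _; lia.
by rewrite big_split/= !sum_eq_ord; lia.
Qed.

(** Each element [h] is counted once for every [t] in [S], at [v = k h - t]. *)
Lemma sum_level_shifts_ge (k : nat -> nat) (S s : seq nat) (V : nat) :
  uniq S -> {in s, forall h, (k h < V)%N} ->
  {in s & S, forall h t, (t <= k h)%N} ->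
  (size S * size s <=
     \sum_(v < V) count (fun h => has (fun t => k h == v + t) S) s)%N.
Proof.
move=> uS; elim: s => [|h s IHs] kV Sk; first by rewrite muln0.
rewrite /= big_split /= mulnS leq_add//; last first.
  apply: IHs => [x xs|x t xs]; first by apply: kV; rewrite inE xs orbT.
  by apply: Sk; rewrite inE xs orbT.
have {kV} hV : (k h < V)%N by apply: kV; rewrite mem_head.
have {Sk} : {in S, forall t, (t <= k h)%N}.
  by move=> t; apply: Sk; rewrite mem_head.
move: uS; clear IHs; elim: S => [//|t S IHS] /= /andP[tS uS] Sk.
have tk : (t <= k h)%N by apply: Sk; rewrite mem_head.
have /IHS : {in S, forall t, (t <= k h)%N}.
  by move=> x xS; apply: Sk; rewrite inE xS orbT.
move=> /(_ uS) {}IHS.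
apply: (@leq_trans (\sum_(v < V) ((k h - t == v)
                     + has (fun t => k h == v + t) S))%N).
  by rewrite big_split/= sum_eq_ord; lia.
apply: leq_sum => v _.
case: (boolP (has _ S)) => [/hasP[u uS' /eqP hu]|_]; last by lia.
have : u != t by apply: contraNneq tS => <-.
by lia.
Qed.

(** * Finite unions, indicators and averages *)

Lemma measure_bigsetU_seq_le d (T : measurableType d) (R : realType)
    (mu : {measure set T -> \bar R}) (I : Type) (A : I -> set T) (s : seq I) :
  (forall h, measurable (A h)) ->
  (mu (\big[setU/set0]_(h <- s) A h) <= \sum_(h <- s) mu (A h))%E.
Proof.
move=> mA; elim: s => [|h s IHs]; first by rewrite !big_nil measure0.
rewrite !big_cons; apply: (le_trans (measureU2 _ _ _)) => //.
  exact: bigsetU_measurable.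
exact: leeD2l.
Qed.

Lemma measure_bigsetU_seq_disjoint d (T : measurableType d) (R : realType)
    (mu : {measure set T -> \bar R}) (I : choiceType) (A : I -> set T)
    (s : seq I) :
  uniq s -> (forall h, measurable (A h)) ->
  {in s &, forall h k, h != k -> A h `&` A k = set0} ->
  mu (\big[setU/set0]_(h <- s) A h) = (\sum_(h <- s) mu (A h))%E.
Proof.
move=> + mA; elim: s => [|h s IHs] /= us dA; first by rewrite !big_nil measure0.
move: us => /andP[hs us].
have mU : measurable (\big[setU/set0]_(k <- s) A k).
  exact: bigsetU_measurable.
rewrite !big_cons measureU//; last first.
  rewrite -bigcup_seq setI_bigcupr bigcup0// => k /= ks.
  by apply: dA; rewrite ?inE ?eqxx ?ks ?orbT//; apply: contraNneq hs => ->.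
congr (_ + _)%E; apply: IHs => // k l ks ls.
by apply: dA; rewrite inE ?ks ?ls orbT.
Qed.

Lemma sume_const (R : realType) (I : Type) (s : seq I) (c : \bar R) :
  (0 <= c)%E -> (\sum_(i <- s) c)%E = ((size s)%:R%:E * c)%E.
Proof.
move=> c0; elim: s => [|i s IHs]; first by rewrite big_nil mul0e.
by rewrite big_cons IHs /= -nat1r EFinD ge0_muleDl// mul1e.
Qed.

Lemma Lnorm_indic d (T : measurableType d) (R : realType)
    (mu : {measure set T -> \bar R}) (p : R) (A : set T) :
  0 < p -> measurable A ->
  Lnorm mu p%:E (EFin \o \1_A) = (mu A `^ p^-1)%E.
Proof.
move=> p0 mA; rewrite unlock; congr (_ `^ _)%E.
rewrite -[X in mu X]setIT -integral_indic//; apply: eq_integral => x _ /=.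
rewrite indicE; case: (x \in A); rewrite ?normr1 ?normr0 ?powR1//.
by rewrite powR0// gt_eqF.
Qed.

Lemma indic_Lfun d (T : measurableType d) (R : realType)
    (mu : {measure set T -> \bar R}) (p : R) (A : set T) :
  0 < p -> measurable A -> (mu A < +oo)%E ->
  (\1_A : T -> R) \in Lfun mu p%:E.
Proof.
move=> p0 mA Afin; apply/andP; rewrite !inE/=; split.
  exact: measurable_indic.
by rewrite /finite_norm Lnorm_indic// poweR_lty.
Qed.

Lemma upper_half_average_ge (R : realType) (N : nat) (a : nat -> R) :
  (0 < N)%N -> (forall n, 0 <= a n) ->
  (forall n, (n <= N < 2 * n)%N -> 1 <= a n) ->
  2^-1 <= N%:R^-1 * \sum_(1 <= n < N.+1) a n.
Proof.
move=> N0 a0 a1; have NR : 0 < N%:R :> R by rewrite ltr0n.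
rewrite mulrC ler_pdivlMr// (@big_cat_nat _ _ _ (N./2).+1)//=; last by lia.
have h1 : 0 <= \sum_(1 <= i < (N./2).+1) a i by apply: sumr_ge0.
have h2 : (N - N./2)%:R <= \sum_((N./2).+1 <= i < N.+1) a i.
  rewrite (_ : (N - N./2)%:R = \sum_((N./2).+1 <= i < N.+1) 1); last first.
    by rewrite sumr_const_nat subSS.
  by apply: ler_sum_nat => n /andP[Hn nN]; apply: a1; lia.
have h3 : N%:R <= (N - N./2)%:R *+ 2 :> R by rewrite -mulrnA ler_nat; lia.
by lra.
Qed.

(** * Multiplication by an integer modulo 1 *)

Lemma frac_part_itv (R : realType) (x : R) : 0 <= frac_part x < 1.
Proof.
rewrite /frac_part; have /andP[] := floor_itv x; rewrite intrD1 => a b.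
by rewrite subr_ge0 a /= ltrBlDl.
Qed.

Lemma frac_part_def (R : realType) (x : R) (m : int) :
  0 <= x - m%:~R < 1 -> frac_part x = x - m%:~R.
Proof.
move=> /andP[h1 h2]; rewrite /frac_part; congr (_ - _%:~R).
by apply: floor_def; rewrite intrD1 -subr_ge0 h1/= -ltrBlDl.
Qed.

Lemma frac_partDz (R : realType) (x : R) (m : int) :
  frac_part (x + m%:~R) = frac_part x.
Proof.
rewrite (@frac_part_def _ (x + m%:~R) (Num.floor x + m)).
  by rewrite /frac_part intrD; ring.
rewrite intrD [X in 0 <= X < _](_ : _ = frac_part x) ?frac_part_itv//.
by rewrite /frac_part; ring.
Qed.

Lemma measurable_frac_part (R : realType) :
  measurable_fun [set: measurableTypeR R]
    (@frac_part R : measurableTypeR R -> measurableTypeR R).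
Proof.
apply: measurable_funB => //; apply: nondecreasing_measurable => //.
by move=> x y xy; rewrite ler_int; exact: le_floor.
Qed.

Definition circle_mul (R : realType) (n : nat) (x : R) : R :=
  frac_part (n%:R * x).

Lemma circle_mulM (R : realType) (g n : nat) (x : R) :
  circle_mul g (circle_mul n x) = circle_mul (g * n) x.
Proof.
rewrite /circle_mul -[RHS](frac_partDz _ (- (g%:Z * Num.floor (n%:R * x)))).
congr frac_part; rewrite natrM {1}/frac_part rmorphN rmorphM /=.
by rewrite -!pmulrn; ring.
Qed.

Lemma measurable_circle_mul (R : realType) (n : nat) :
  measurable_fun [set: measurableTypeR R]
    (@circle_mul R n : measurableTypeR R -> measurableTypeR R).
Proof.
apply: (measurableT_comp (@measurable_frac_part R)).
exact: measurable_funM.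
Qed.

(** The pushforward of Lebesgue measure, multiplied by [a], agrees with
    Lebesgue measure on half-open intervals, and these determine it. *)
Lemma lebesgue_measure_affine (R : realType) (a c : R)
    (A : set (measurableTypeR R)) : 0 < a -> measurable A ->
  lebesgue_measure ((fun x : measurableTypeR R => a * x - c : R) @^-1` A)
    = (a^-1%:E * lebesgue_measure A)%E.
Proof.
move=> a0 mA.
have mf : measurable_fun [set: measurableTypeR R]
   (fun x : measurableTypeR R => a * x - c : measurableTypeR R).
  by apply: measurable_funB => //; apply: measurable_funM.
set f := (f in f @^-1` A) in mf *.
(* A pushforward is a measure only given a proof that the map is measurable,
   which unification cannot recover from the bare map; hence the structure is
   given by name. *)
have HA : lebesgue_measure A = mscale (NngNum (ltW a0))
    (measure_function_pushforward__canonical__measure_function_Measure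
       (@lebesgue_measure R) mf) A.
  apply: lebesgue_measure_unique => //= _ [[u v] _ <-].
  have fE : f @^-1` `]u, v] = `](u + c) / a, (v + c) / a]%classic :> set R.
    apply/seteqP; split => x /=; rewrite !in_itv/= ltr_pdivrMr// ler_pdivlMr//
      [x * _]mulrC /f; lra.
  transitivity (a%:E * lebesgue_measure (f @^-1` `]u, v]))%E; last by [].
  rewrite fE !lebesgue_measure_itv/= !lte_fin ltr_pM2r ?invr_gt0// ltrD2r.
  case: ltrP => uv; last by rewrite mule0.
  by rewrite -!EFinB -EFinM; congr _%:E; field; rewrite gt_eqF.
by rewrite HA /mscale/= muleA -EFinM mulVf ?gt_eqF// mul1e.
Qed.

Lemma leb01E (R : realType) (A : set R) :
  leb01 R A = lebesgue_measure (A `&` `[0, 1[).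
Proof. by []. Qed.

Lemma leb01_itv (R : realType) (a b : R) : 0 <= a -> a <= b -> b <= 1 ->
  leb01 R `[a, b[%classic = (b - a)%:E.
Proof.
move=> a0 ab b1; rewrite leb01E.
rewrite (_ : _ `&` _ = `[a, b[%classic :> set R); last first.
  apply/seteqP; split => x /=; rewrite !in_itv/=; first by case.
  by move=> H; split => //; lra.
rewrite lebesgue_measure_itv/= lte_fin; case: ltrP => // ba.
by rewrite (_ : b - a = 0)//; lra.
Qed.

(** The [i]-th piece is the part of the preimage lying in
    [[i / n, (i + 1) / n)], the interval on which [circle_mul n] is the affine
    map [x |-> n * x - i]. *)
Lemma circle_mul_preimage (R : realType) (n : nat) (B : set R) : (0 < n)%N ->
  (@circle_mul R n @^-1` B) `&` `[0, 1[ =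
  \big[setU/set0]_(i <- iota 0 n)
    ((fun x : R => n%:R * x - i%:R) @^-1` (B `&` `[0, 1[)).
Proof.
move=> n0; have nR : 0 < n%:R :> R by rewrite ltr0n.
rewrite -bigcup_seq; apply/seteqP; split => x /=.
  rewrite in_itv/= => -[Bx /andP[x0 x1]].
  have nx0 : 0 <= n%:R * x by rewrite mulr_ge0// ltW.
  have : (0 <= Num.floor (n%:R * x)) by rewrite floor_ge0.
  have : Num.floor (n%:R * x) < n by rewrite floor_lt_int -pmulrn gtr_pMr.
  have := frac_part_itv (n%:R * x).
  move: Bx; rewrite /circle_mul /frac_part.
  case: (Num.floor _) => // i Bx i01 i_n _; exists i.
    by rewrite /= mem_iota.
  by rewrite /= in_itv/=; split; rewrite pmulrn.
move=> [i /=]; rewrite mem_iota add0n /= => i_n; rewrite !in_itv/= => -[Bx i01].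
have i_n' : i%:R + 1 <= n%:R :> R by rewrite natr1 ler_nat.
have xE : circle_mul n x = n%:R * x - i%:R.
  by rewrite /circle_mul (@frac_part_def _ _ i) -?pmulrn.
rewrite xE; split => //; case/andP: i01 => i0 i1.
rewrite -(pmulr_rge0 _ nR) -(ltr_pM2l nR) mulr1.
have : 0 <= i%:R :> R by [].
lra.
Qed.

(** Each of the [n] affine pieces contributes [leb01 B / n]. *)
Lemma leb01_circle_mul (R : realType) (n : nat) (B : set (measurableTypeR R)) :
  (0 < n)%N -> measurable B -> leb01 R (@circle_mul R n @^-1` B) = leb01 R B.
Proof.
move=> n0 mB; rewrite !leb01E circle_mul_preimage//.
have mB01 : measurable (B `&` `[0, 1[ : set (measurableTypeR R)).
  by apply: measurableI => //; exact: measurable_itv.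
have nR : 0 < n%:R :> R by rewrite ltr0n.
rewrite measure_bigsetU_seq_disjoint ?iota_uniq//; last 2 first.
- move=> i; rewrite -[X in measurable X]setTI.
  have : measurable_fun [set: measurableTypeR R]
     (fun x : measurableTypeR R => n%:R * x - i%:R : measurableTypeR R).
    by apply: measurable_funB => //; apply: measurable_funM.
  exact.
- move=> i j _ _ ij; rewrite -subset0 => x /=.
  rewrite !in_itv/= => -[[_ ix] [_ jx]]; move/eqP: ij; apply.
  have xi := @frac_part_def _ (n%:R * x) i ix.
  have xj := @frac_part_def _ (n%:R * x) j jx.
  have : i%:R = j%:R :> R by move: xi; rewrite xj -!pmulrn; lra.
  by move/eqP; rewrite eqr_nat => /eqP.
transitivity (\sum_(i <- iota 0 n)
    ((n%:R^-1)%:E * lebesgue_measure (B `&` `[0%R, 1%R[)))%E.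
  by apply: eq_bigr => i _; exact: lebesgue_measure_affine.
rewrite sume_const ?size_iota; last by rewrite mule_ge0.
by rewrite muleA -EFinM mulfV ?gt_eqF// mul1e.
Qed.

(** If [h x] and [k x] are [1/q + theta] and [1/q + theta'] modulo 1, then
    [k * (h x) = h * (k x)] shows that [(k - h) / q] differs from an integer by
    [h theta' - k theta], which is less than [1/q] in absolute value.  Hence
    [q] divides [k - h], although [0 < |k - h| < q]. *)
Lemma circle_mul_preimages_disjoint (R : realType) (q h k : nat) :
  (0 < h < q)%N -> (0 < k < q)%N -> h != k ->
  let D : set R := `[q%:R^-1, q%:R^-1 + q%:R^-2[%classic in
  (@circle_mul R h @^-1` D) `&` (@circle_mul R k @^-1` D) = set0.
Proof.
move=> /andP[h0 hq] /andP[k0 kq] hk D; rewrite -subset0 => x /=.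
rewrite /D/= !in_itv/= /circle_mul /frac_part.
move: (Num.floor (h%:R * x)) (Num.floor (k%:R * x)) => i j.
move=> [/andP[hl hu] /andP[kl ku]].
have q0 : 0 < q%:R :> R by rewrite ltr0n (leq_ltn_trans _ hq).
have hqR : h%:R < q%:R :> R by rewrite ltr_nat.
have kqR : k%:R < q%:R :> R by rewrite ltr_nat.
have h0R : 0 < h%:R :> R by rewrite ltr0n.
have k0R : 0 < k%:R :> R by rewrite ltr0n.
pose a := q%:R * (h%:R * x - i%:~R) - 1.
pose b := q%:R * (k%:R * x - j%:~R) - 1.
have aE : 0 <= a < q%:R^-1.
  rewrite /a subr_ge0 ltrBlDr -ler_pdivrMl// -ltr_pdivlMl// mulr1 hl/=.
  by rewrite (lt_le_trans hu)// mulrDr mulr1 addrC -expr2 exprVn.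
have bE : 0 <= b < q%:R^-1.
  rewrite /b subr_ge0 ltrBlDr -ler_pdivrMl// -ltr_pdivlMl// mulr1 kl/=.
  by rewrite (lt_le_trans ku)// mulrDr mulr1 addrC -expr2 exprVn.
pose m : int := k%:Z - h%:Z + q%:Z * (k%:Z * i - h%:Z * j).
have mE : m%:~R = h%:R * b - k%:R * a :> R.
  by rewrite /m /a /b !(rmorphD, rmorphB, rmorphM)/= -!pmulrn; ring.
have : (-1 < m%:~R :> R) && (m%:~R < 1 :> R).
  have qV : q%:R * q%:R^-1 = 1 :> R by rewrite mulfV ?gt_eqF.
  have qV0 : 0 < q%:R^-1 :> R by rewrite invr_gt0.
  case/andP: aE => a0 aq; case/andP: bE => b0 bq.
  have hb : h%:R * b < 1 by nra.
  have ka : k%:R * a < 1 by nra.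
  have hb0 : 0 <= h%:R * b by rewrite mulr_ge0// ltW.
  have ka0 : 0 <= k%:R * a by rewrite mulr_ge0// ltW.
  by rewrite mE; lra.
rewrite (_ : -1 = (-1)%:~R :> R)// (_ : 1 = 1%:~R :> R)// !ltr_int => m0.
have {}m0 : m = 0 by lia.
have [e|e] := eqVneq (k%:Z * i - h%:Z * j) 0.
  by move: m0; rewrite /m e mulr0; move/eqP: hk; lia.
by move: m0; rewrite /m; nia.
Qed.

(** * Dilations as operators *)

Lemma ge0_integral_circle_mul (R : realType) (n : nat)
    (g : measurableTypeR R -> \bar R) : (0 < n)%N ->
  measurable_fun setT g -> (forall x, 0 <= g x)%E ->
  (\int[leb01 R]_x g (circle_mul n x) = \int[leb01 R]_x g x)%E.
Proof.
move=> n0 mg g0; have mn := @measurable_circle_mul R n.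
rewrite -[LHS](@ge0_integral_pushforward _ _ _ _ R _ mn (leb01 R) setT)//.
apply: (@eq_measure_integral _ _ _ _ (leb01 R)
  (measure_function_pushforward__canonical__measure_function_Measure
     (leb01 R) mn)).
by move=> A mA _; exact: leb01_circle_mul.
Qed.

Lemma dilation_Lp_linear_operator (R : realType) (p : R) (n : nat) :
  (0 < n)%N -> Lp_linear_operator (leb01 R) p (@dilation R n).
Proof.
move=> n0; split.
- move=> f; rewrite !inE => /andP[]; rewrite !inE/= => mf nf.
  apply/andP; rewrite !inE/=; split.
    exact: (measurableT_comp mf (@measurable_circle_mul R n)).
  move: nf; rewrite /finite_norm unlock => nf.
  rewrite [X in (X `^ _)%E](_ : _ = \int[leb01 R]_x `|(EFin \o f) x| `^ p)%E//.
  apply: (@ge0_integral_circle_mul _ _ (fun x => `|(EFin \o f) x| `^ p)%E) => //.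
  + apply: (measurableT_comp (measurable_poweR p)).
    by apply: measurableT_comp => //; exact/measurable_EFinP.
  + by move=> x; exact: poweR_ge0.
- move=> f g fL gL [N [mN N0 fgN]]; exists (@circle_mul R n @^-1` N); split.
  + by rewrite -[X in measurable X]setTI; exact: measurable_circle_mul.
  + by rewrite leb01_circle_mul.
  + by move=> x /= fgx; apply: fgN => /= H; apply: fgx; exact: H.
- by move=> a f g _ _; apply: aeW.
Qed.

Lemma measurable_weighted_maximal_dilation (R : realType) (w : nat -> R)
    (f : measurableTypeR R -> R) : measurable_fun setT f ->
  measurable_fun [set: measurableTypeR R] (weighted_maximal (@dilation R) w f).
Proof.
move=> mf; pose h t (x : measurableTypeR R) :=
  (w t * ((2 ^ t)%:R^-1 * \sum_(1 <= n < (2 ^ t).+1) dilation n f x))%:E.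
have -> : weighted_maximal (@dilation R) w f = fun x => esups (h ^~ x) 0%N.
  apply/funext => x; rewrite /weighted_maximal /esups; congr ereal_sup.
  by apply/seteqP; split => _ [t _ <-]; exists t.
apply: measurable_fun_esups => t; apply/measurable_EFinP.
apply: measurable_funM => //; apply: measurable_funM => //.
apply: measurable_sum => n.
exact: (measurableT_comp mf (@measurable_circle_mul R n)).
Qed.

(** * From the weak-type inequality to cardinals *)

(** The weak-type inequality is applied to the indicator of the union [A] of
    the sets [g^-1 D], [g] in [F].  On the disjoint union [B] of the sets
    [h^-1 D], [h] in [E], the maximal function is at least [y / 2]: for the [t]
    attached to [h], at least half of the dilations in the [t]-th average send
    the point into [A]. *)
Lemma weak_type_size_le (R : realType) (p C y : R) (w : nat -> R)
    (S F E : seq nat) : 0 < p -> 0 < C -> 0 < y ->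
  (forall f, f \in Lfun (leb01 R) p%:E ->
    (weak_Lnorm (leb01 R) p (weighted_maximal (@dilation R) w f)
       <= C%:E * Lnorm (leb01 R) p%:E (EFin \o f))%E) ->
  {in S, forall t, y <= w t} -> uniq E ->
  {in F, forall g, (0 < g)%N} -> {in E, forall h, (0 < h)%N} ->
  {in E, forall h, exists2 t, t \in S &
     forall n, (n <= 2 ^ t < 2 * n)%N -> exists2 g, g \in F & h = (g * n)%N} ->
  (y / 2) `^ p * (size E)%:R <= C `^ p * (size F)%:R.
Proof.
move=> p0 C0 y0 weak Sy uE F0 E0 EF.
(* Besides exceeding every h, q must be at least 2 for D to lie in [0, 1). *)
pose q := (\max_(h <- E) h).+2.
have qR : 2 <= q%:R :> R by rewrite ler_nat.
have qV : q%:R * q%:R^-1 = 1 :> R by rewrite mulfV// gt_eqF//; lra.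
have qV0 : 0 < q%:R^-1 :> R by rewrite invr_gt0; lra.
pose D : set (measurableTypeR R) := `[q%:R^-1, q%:R^-1 + q%:R^-2[%classic.
have mD : measurable D by exact: measurable_itv.
pose delta : R := q%:R^-2.
have d0 : 0 < delta by rewrite invr_gt0 exprn_gt0//; lra.
have d0E : (0 <= delta%:E)%E by rewrite lee_fin ltW.
have muD : leb01 R D = delta%:E.
  rewrite leb01_itv ?ltW// ?ltrDl//; first by rewrite addrAC subrr add0r.
  by rewrite -exprVn expr2; nra.
have mP h : measurable (@circle_mul R h @^-1` D : set (measurableTypeR R)).
  by rewrite -[X in measurable X]setTI; exact: measurable_circle_mul.
have muP h : (0 < h)%N -> leb01 R (@circle_mul R h @^-1` D) = delta%:E.
  by move=> h0; rewrite leb01_circle_mul.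
pose A : set (measurableTypeR R) :=
  \big[setU/set0]_(g <- F) (@circle_mul R g @^-1` D).
pose B : set (measurableTypeR R) :=
  \big[setU/set0]_(h <- E) (@circle_mul R h @^-1` D).
have mA : measurable A by exact: bigsetU_measurable.
have mB : measurable B by exact: bigsetU_measurable.
have muA : (leb01 R A <= ((size F)%:R * delta)%:E)%E.
  apply: (le_trans (measure_bigsetU_seq_le _ _ _)) => //.
  rewrite EFinM -sume_const// big_seq [X in (_ <= X)%E]big_seq.
  by apply: lee_sum => g /F0/muP ->.
have muB : leb01 R B = ((size E)%:R * delta)%:E.
  rewrite measure_bigsetU_seq_disjoint//.
    by rewrite EFinM -sume_const//; apply: eq_big_seq => h /E0/muP ->.
  have Eq h : h \in E -> (0 < h < q)%N.
    by move=> hE; rewrite E0//= /q ltnS leqW//; apply: leq_bigmax_seq.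
  by move=> h k /Eq hq /Eq kq hk; exact: circle_mul_preimages_disjoint.
have fL : (\1_A : measurableTypeR R -> R) \in Lfun (leb01 R) p%:E.
  by apply: indic_Lfun => //; apply: le_lt_trans muA _; rewrite ltry.
have Mf x : B x -> ((y / 2)%:E <= weighted_maximal (@dilation R) w \1_A x)%E.
  rewrite /B -bigcup_seq => -[h /= hE hx].
  have [t tS tF] := EF h hE.
  apply: ereal_sup_ge; eexists; first by exists t.
  rewrite lee_fin; apply: ler_pM; [exact: ltW|by []|exact: Sy|].
  apply: upper_half_average_ge; rewrite ?expn_gt0// => n.
  move=> /tF[g gF hgn]; rewrite /dilation indicE mem_set// /A -bigcup_seq.
  exists g => //=.
  by rewrite -/(circle_mul n x) circle_mulM -hgn.
have := weak _ fL; rewrite Lnorm_indic//.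
set M := weighted_maximal _ _ _ in Mf *.
have mM : measurable_fun [set: measurableTypeR R] M.
  by apply: measurable_weighted_maximal_dilation; exact: measurable_indic.
move=> weakA.
have : ((y / 2)%:E * leb01 R B `^ p^-1
    <= C%:E * ((size F)%:R * delta)%:E `^ p^-1)%E.
  apply: le_trans (le_trans weakA _); last first.
    apply: lee_wpmul2l; first by rewrite lee_fin ltW.
    apply: gt0_ler_poweR => //.
    + by rewrite invr_ge0 ltW.
    + by rewrite in_itv/= leey andbT.
    + by rewrite in_itv/= leey andbT lee_fin mulr_ge0// ltW.
  apply: ereal_sup_ge; eexists; first by exists (y / 2) => //=; rewrite divr_gt0.
  apply: lee_wpmul2l; first by rewrite lee_fin divr_ge0// ltW.
  apply: gt0_ler_poweR; rewrite ?invr_ge0 ?in_itv/= ?leey ?andbT ?(ltW p0)//.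
  rewrite le_measure ?inE//.
    rewrite -[X in measurable X]setTI; apply: emeasurable_fun_c_infty => //.
    exact: measurableT_comp.
  by move=> x /Mf /= H; apply: le_trans H _; exact: lee_abs.
rewrite muB !poweR_EFin -!EFinM lee_fin => H.
have : ((y / 2) * ((size E)%:R * delta) `^ p^-1) `^ p
    <= (C * ((size F)%:R * delta) `^ p^-1) `^ p.
  apply: ge0_ler_powR => //; rewrite ?nnegrE ?mulr_ge0 ?powR_ge0 ?(ltW C0)//.
    exact: ltW.
  exact: ltW.
have y20 : 0 <= y / 2 by rewrite divr_ge0// ltW.
have pV : p^-1 * p = 1 by rewrite mulVf// gt_eqF.
have sd n : 0 <= n%:R * delta by rewrite mulr_ge0// ltW.
rewrite powRM ?powR_ge0// [in leRHS]powRM ?powR_ge0 ?(ltW C0)//.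
by rewrite -!powRrM pV !powRr1// !mulrA ler_pM2r.
Qed.

(** For each level [v], [weak_type_size_le] is applied to the [h] of [s'] whose
    level is [v + t] for some [t] in [S], and to the [g] of [s] whose level is
    [v] or [v + 1].  Summed over [v], the first family has
    [size S * size s'] elements and the second one at most
    [2 * size s <= 4 * size s']. *)
Lemma weak_type_level_set_le (R : realType) (p C y : R) (w : nat -> R)
    (S : seq nat) : 0 < p -> 0 < C -> 0 < y ->
  (forall f, f \in Lfun (leb01 R) p%:E ->
    (weak_Lnorm (leb01 R) p (weighted_maximal (@dilation R) w f)
       <= C%:E * Lnorm (leb01 R) p%:E (EFin \o f))%E) ->
  uniq S -> {in S, forall t, y <= w t} ->
  (y / 2) `^ p * (size S)%:R <= 4 * C `^ p.
Proof.
move=> p0 C0 y0 weak uS Sy.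
pose T := (\max_(t <- S) t)%N.
have ST t : t \in S -> (t <= T)%N by move=> tS; exact: leq_bigmax_seq.
have [s [s' [[us us' s'0 ss'] [s_gt0 s'_ge s'_div]]]] := folner_smooth (2 ^ T).
pose k h := trunc_log 2 h.
pose V := (\max_(h <- s') k h).+1.
pose F v := [seq g <- s | (k g == v) || (k g == v.+1)].
pose E v := [seq h <- s' | has (fun t => k h == (v + t)%N) S].
have level v : (y / 2) `^ p * (size (E v))%:R <= C `^ p * (size (F v))%:R.
  apply: (@weak_type_size_le _ _ _ _ w S) => //.
  - exact: filter_uniq.
  - by move=> g; rewrite mem_filter => /andP[_ /s_gt0].
  - move=> h; rewrite mem_filter => /andP[_ /s'_ge]; apply: leq_trans.
    by rewrite expn_gt0.
  move=> h; rewrite mem_filter => /andP[/hasP[t tS /eqP kh] hs'].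
  exists t => // n nt.
  have nK : (0 < n <= 2 ^ T)%N.
    case/andP: nt => nt tn; rewrite (leq_trans nt) ?leq_exp2l ?ST// andbT.
    by case: n tn {nt} => //; rewrite muln0.
  have [g gs hgn] := s'_div h hs' n nK.
  exists g => //; rewrite mem_filter gs andbT.
  by apply: (trunc_log_quotient nt); rewrite -?hgn// s_gt0.
have : \sum_(v < V) (y / 2) `^ p * (size (E v))%:R
    <= \sum_(v < V) C `^ p * (size (F v))%:R by apply: ler_sum.
rewrite -!mulr_sumr -!natr_sum => sumle.
have Fle : (\sum_(v < V) size (F v) <= 2 * size s)%N.
  under eq_bigr do rewrite size_filter.
  exact: sum_level_pairs_le.
have Ege : (size S * size s' <= \sum_(v < V) size (E v))%N.
  under eq_bigr do rewrite size_filter.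
  apply: sum_level_shifts_ge => //.
    by move=> h hs'; rewrite ltnS; exact: leq_bigmax_seq.
  move=> h t /s'_ge hK /ST tT; apply: (leq_trans tT).
  by rewrite /k -(trunc_expnK T (ltnSn 1)); exact: leq_trunc_log.
have y2 : 0 <= (y / 2) `^ p := powR_ge0 _ _.
have Cp : 0 <= C `^ p := powR_ge0 _ _.
have s'R : 0 < (size s')%:R :> R by rewrite ltr0n.
rewrite -(ler_pM2r s'R).
have h1 : (y / 2) `^ p * (size S)%:R * (size s')%:R
    <= (y / 2) `^ p * (\sum_(v < V) size (E v))%:R.
  by rewrite -mulrA -natrM ler_wpM2l// ler_nat.
have h2 : C `^ p * (\sum_(v < V) size (F v))%:R <= C `^ p * (4 * (size s')%:R).
  by rewrite -natrM ler_wpM2l// ler_nat; lia.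
apply: (le_trans h1); apply: (le_trans sumle); apply: (le_trans h2).
by rewrite mulrA [C `^ p * _]mulrC.
Qed.

Theorem theorem5p2 (R : realType) (p : R) (hp : 1 < p) :
  ultimately_bad (leb01 R) p (@dilation R).
Proof.
have p0 : 0 < p by apply: lt_trans hp.
split; first by move=> n; exact: dilation_Lp_linear_operator.
move=> w w0 winf [C C0 weak].
pose K := 4 * C `^ p.
have level y (S : seq nat) : 0 < y -> uniq S -> {in S, forall t, y <= w t} ->
    (y / 2) `^ p * (size S)%:R <= K.
  by move=> y0; exact: weak_type_level_set_le.
have K0 : 0 <= K by rewrite mulr_ge0 ?powR_ge0.
suff : (weak_seq_norm p w <= (2 * K `^ p^-1)%:E)%E by rewrite winf leNgt ltry.
apply: ge_ereal_sup => _ [y /= y0 <-].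
set A := [set t | _].
have Aw t : A t -> y <= w t by rewrite /A/= lee_fin ger0_norm// ltW.
have y2 : 0 < (y / 2) `^ p by rewrite powR_gt0// divr_gt0.
have Afin : finite_set A.
  apply: contrapT => Ainf.
  (* More elements of A than the bound K / (y / 2)^p on their number allows. *)
  have [B BA sB] := infinite_set_fset (Num.truncn (K / (y / 2) `^ p)).+1 Ainf.
  have := level y (finmap.enum_fset B) y0 (finmap.fset_uniq B)
    (fun t tB => Aw t (BA t tB)).
  rewrite mulrC -ler_pdivlMr// leNgt => /negP; apply.
  by apply: (lt_le_trans (truncnS_gt _)); rewrite ler_nat.
rewrite /counting asboolT// poweR_EFin -EFinM lee_fin.
have := level y (finmap.enum_fset (fset_set A)) y0 (finmap.fset_uniq _).
have FA : {in finmap.enum_fset (fset_set A), forall t, y <= w t}.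
  by move=> t tA; apply: Aw; move: tA; rewrite in_fset_set// => /set_mem.
move=> /(_ FA); set N := size _ => le_K.
have : ((y / 2) `^ p * N%:R) `^ p^-1 <= K `^ p^-1.
  apply: ge0_ler_powR => //; rewrite ?nnegrE ?invr_ge0 ?mulr_ge0 ?powR_ge0//.
  exact: ltW.
rewrite powRM ?powR_ge0// -powRrM mulfV ?gt_eqF// powRr1 ?divr_ge0 ?(ltW y0)//.
by rewrite -/N; lra.
Qed.
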